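(* Let $Y$ be a real valued random variable with mean $\mu$ and variance $\sigma^2$. (i) If $\mu>1$, then $$E\left(\frac{1}{Y\vee 1}\right)\leq 1-\frac{(\mu-1)^2}{\sigma^2+\mu^2-\mu},$$ with equality if $Y$ takes on the values $1$ and $\mu+\sigma^2/(\mu-1)$ with probabilities $$P(Y=1)=\frac{\sigma^2}{\sigma^2+(\mu-1)^2},\qquad P\left(Y=\mu+\frac{\sigma^2}{\mu-1}\right)=\frac{(\mu-1)^2}{\sigma^2+(\mu-1)^2}.$$ (ii) If $\mu<1$, then the upper bound to $E(1/(Y\vee1))$ is $1$, with equality if, e.g., $Y$ has the two-point distribution given by the same formulas as in (i). (iii) If $\mu=1$, then the sharp upper bound to $E(1/(Y\vee 1))$ is $1$ too, but if $\sigma^2>0$ it cannot be attained, only approached, by e.g. the random variable $Y_\epsilon$, $\epsilon>0$, defined by $$P(Y_\epsilon=1+\epsilon)=\frac{\sigma^2}{\sigma^2+\epsilon^2},\qquad P\left(Y_\epsilon=1-\frac{\sigma^2}{\epsilon}\right)=\frac{\epsilon^2}{\sigma^2+\epsilon^2};$$ indeed $$E\left(\frac{1}{Y_\epsilon\vee1}\right)=1-\frac{\sigma^2\epsilon}{(\sigma^2+\epsilon^2)(1+\epsilon)}\uparrow 1\quad\text{as }\epsilon\downarrow0.$$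
   Context: Here $a\vee b=\max\{a,b\}$, and the variance $\sigma^2$ is finite. *)

(* Defs.v *)
From mathcomp Require Export all_boot all_order all_algebra.
From mathcomp Require Export all_classical all_reals all_analysis.

Set Implicit Arguments.
Unset Strict Implicit.
Unset Printing Implicit Defensive.

Export Order.TTheory GRing.Theory Num.Theory.
Export numFieldNormedType.Exports.

Local Open Scope classical_set_scope.
Local Open Scope ring_scope.

(* Since +oo - oo = -oo in \bar R, an integral with a finite value is that of
   an integrable function: the two equations below entail that Y and
   (Y - m)^2 are integrable. *)
Definition has_mean_variance (R : realType) (d : measure_display)
    (T : measurableType d) (P : probability T R) (Y : {RV P >-> R})
    (m v : R) : Prop :=
  'E_P[Y]%E = m%:E /\ 'V_P[Y]%E = v%:E.

Definition expectation_inv_max1 (R : realType) (d : measure_display)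
    (T : measurableType d) (P : probability T R) (Y : {RV P >-> R}) : \bar R :=
  'E_P[fun w => (1 / Num.max (Y w) 1)%R]%E.

(* Used only for x != y and p + q = 1, when this determines the law of Y. *)
Definition two_point_law (R : realType) (d : measure_display)
    (T : measurableType d) (P : probability T R) (Y : {RV P >-> R})
    (x p y q : R) : Prop :=
  P (Y @^-1` [set x]) = p%:E /\ P (Y @^-1` [set y]) = q%:E.

(* The values of E(1/(Y \/ 1)) over all Y, on any probability space, with mean
   m and variance v; a sharp upper bound is a supremum of this set. *)
Definition inv_max1_values (R : realType) (m v : R) : set (\bar R) :=
  [set e | exists (d : measure_display) (T : measurableType d)
             (P : probability T R) (Y : {RV P >-> R}),
             has_mean_variance Y m v /\ e = expectation_inv_max1 Y].

(* Main.v *)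
Require Import Defs.
From mathcomp Require Import measurable_realfun ring lra.

(** The function [1 / Num.max y 1] is bounded by the parabola that passes
    through the point (1, 1) and is tangent to [1 / y] at a point [a >= 1]
    ([inv_max1_le_tangent_parabola]).  The mean and the variance of [Y] determine
    the expectation of a quadratic polynomial in [Y], so every choice of [a]
    gives a bound on E(1/(Y \/ 1)) in terms of these two moments only
    ([expectation_le_quadratic]).  Parabola and function agree exactly at 1 and
    [a]; hence the bound is optimal when a law carried by these two points has
    the prescribed moments, which forces [a = mu + v / (mu - 1)], and then such a
    law attains it.  This is the case [1 < mu].

    If [mu < 1], the same two points both lie in the region [y <= 1] where
    the function is constantly 1, the trivial upper bound.

    If [mu = 1], the value 1 would require [Y <= 1] almost surely; a variable
    that never exceeds its own mean is almost surely equal to it, so its variance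
    vanishes ([expectation_inv_max1_neq1]).  The value is approached by putting
    most of the mass at [1 + eps] and compensating the mean by a small mass at
    distance of order [1 / eps] below 1, where the function equals 1: the expectation
    is at least [1 - eps] ([critical_value_bounds]).

    Expectations under a two-point law are computed by replacing [g \o Y]
    with an almost surely equal combination of two indicators
    ([expectation_two_point]); the existence of a two-point law comes from a
    Bernoulli variable. *)

Set Implicit Arguments.
Unset Strict Implicit.
Unset Printing Implicit Defensive.

Local Open Scope classical_set_scope.
Local Open Scope ring_scope.

(** * Moments of a real random variable *)

Section moments.
Context (R : realType) (d : measure_display) (T : measurableType d)
  (P : probability T R).

Lemma expectation_eq0_ae (X : T -> R) : measurable_fun setT X ->
  {ae P, forall w, 0 <= X w} -> 'E_P[X]%E = 0%E -> {ae P, forall w, X w = 0}.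
Proof.
move=> mX X_ge0 EX.
have mEX : measurable_fun setT (EFin \o X) by exact/measurable_EFinP.
have absX : (\int[P]_w `|(EFin \o X) w| = 0)%E.
  rewrite -EX unlock; apply: ae_eq_integral => //.
    exact: measurableT_comp.
  by apply: filterS X_ge0 => w Xw _ /=; rewrite ger0_norm.
have /ae_eq_integral_abs := absX => /(_ measurableT mEX).
by apply: filterS => w /(_ I) /= [].
Qed.

Variable Y : {RV P >-> R}.

(** The covariance is centred at [fine 'E_P[Y]], which is [m] only once the
    expectation is known to be the finite number [m]: the two equations have to be
    rewritten together. *)
Lemma has_mean_varianceE (m v : R) : has_mean_variance Y m v <->
  'E_P[Y]%E = m%:E /\ 'E_P[fun w => ((Y w - m) ^+ 2)%R]%E = v%:E.
Proof.
have VE : 'E_P[Y]%E = m%:E -> 'V_P[Y]%E = 'E_P[fun w => ((Y w - m) ^+ 2)%R]%E.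
  move=> EY; rewrite /variance covariance.unlock EY /=; congr expectation.
by split=> -[EY VY]; split=> //; move: VY; rewrite VE.
Qed.

(** A nonnegative function with finite integral is integrable, which settles
    the square; the centred variable itself follows from [`|z| <= 1 + z ^+ 2]. *)
Lemma Lfun1_centered (m v : R) : has_mean_variance Y m v ->
  (fun w => Y w - m) \in Lfun P 1 /\ (fun w => (Y w - m) ^+ 2) \in Lfun P 1.
Proof.
move=> /has_mean_varianceE[_ VY].
have mZ : measurable_fun setT (fun w : T => Y w - m).
  by apply: measurable_funB.
have Z2 : P.-integrable setT (EFin \o (fun w => (Y w - m) ^+ 2)).
  apply/integrableP; split.
    by apply/measurable_EFinP; exact: measurable_funX.
  under eq_integral do rewrite /= ger0_norm ?sqr_ge0//.
  by move: VY; rewrite unlock => ->; rewrite ltry.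
split; apply/Lfun1_integrable => //.
apply: (@le_integrable _ _ _ _ _ _ _
    (EFin \o (cst 1 \+ (fun w => (Y w - m) ^+ 2)))) => //.
- exact/measurable_EFinP.
- move=> w _ /=; rewrite lee_fin.
  rewrite (@ger0_norm _ (1 + _)) ?addr_ge0 ?sqr_ge0//.
  move: (Y w - m : R) => z; rewrite ler_norml.
  have := sqr_ge0 (z - 1); have := sqr_ge0 (z + 1); rewrite sqrrB1 sqrrD1.
  by move=> ? ?; apply/andP; split; lra.
- by apply/Lfun1_integrable; rewrite rpredD ?Lfun_cst//; exact/Lfun1_integrable.
Qed.

(** Polynomials are written in powers of [Y - m], so that the linear coefficient
    drops out. *)
Lemma expectation_quadratic (m v c0 c1 c2 : R) : has_mean_variance Y m v ->
  'E_P[fun w => (c0 + c1 * (Y w - m) + c2 * (Y w - m) ^+ 2)%R]%E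
  = (c0 + c2 * v)%:E.
Proof.
move=> mvY; have [Z1 Z2] := Lfun1_centered mvY.
have [EY VY] := (has_mean_varianceE m v).1 mvY.
have Y1 : (Y : T -> R) \in Lfun P 1.
  rewrite (_ : (Y : T -> R) = (fun w => Y w - m) \+ cst m).
    by rewrite rpredD ?Lfun_cst.
  by apply/funext => w /=; rewrite subrK.
have EZ : 'E_P[fun w => (Y w - m)%R]%E = 0%E.
  have := expectationB Y1 (Lfun_cst P m 1).
  by rewrite EY expectation_cst -EFinB subrr.
rewrite (_ : (fun w => _) = (cst c0 \+ (c1 \o* (fun w => Y w - m))) \+
   (c2 \o* (fun w => (Y w - m) ^+ 2))); last first.
  by apply/funext => w /=; ring.
rewrite !expectationD ?rpredD ?Lfun_scale ?Lfun_cst//.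
by rewrite expectation_cst !expectationZl// EZ VY mule0 adde0 -EFinM -EFinD.
Qed.

Lemma expectation_le_quadratic (m v c0 c1 c2 : R) (g : R -> R) :
  has_mean_variance Y m v -> measurable_fun setT g ->
  (forall y, 0 <= g y <= c0 + c1 * (y - m) + c2 * (y - m) ^+ 2) ->
  ('E_P[g \o Y] <= (c0 + c2 * v)%:E)%E.
Proof.
move=> mvY mg gle; rewrite -(expectation_quadratic c0 c1 c2 mvY).
apply: expectation_le.
- exact: measurableT_comp.
- apply: measurable_funD; [apply: measurable_funD => //|];
    apply: measurable_funM => //; [|apply: measurable_funX];
    by apply: measurable_funB.
- by move=> w /=; have /andP[] := gle (Y w).
- by move=> w; have /andP[] := gle (Y w); exact: le_trans.
- by apply: aeW => w /=; have /andP[] := gle (Y w).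
Qed.

(** As [p + q = 1], the complement of the two fibres is a null set, so [g \o Y]
    is almost surely a combination of the indicators of the fibres. *)
Lemma expectation_two_point (x p y q : R) (g : R -> R) :
  x != y -> p + q = 1 -> two_point_law Y x p y q -> measurable_fun setT g ->
  'E_P[g \o Y]%E = (p * g x + q * g y)%:E.
Proof.
move=> xy pq [Px Py] mg.
set A := Y @^-1` [set x]; set B := Y @^-1` [set y].
have mY z : measurable (Y @^-1` [set z]).
  rewrite -[_ @^-1` _]setTI.
  by apply: measurable_funP => //; exact: measurable_set1.
have [mA mB] : measurable A /\ measurable B by split; exact: mY.
have AB0 : A `&` B = set0.
  by rewrite -subset0 => w [/= Yx Yy]; move: xy; rewrite -Yx -Yy eqxx.
pose s : T -> R := (g x \o* \1_A) \+ (g y \o* \1_B).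
have A1 : (\1_A : T -> R) \in Lfun P 1.
  by apply/Lfun1_integrable; exact: integrable_indic.
have B1 : (\1_B : T -> R) \in Lfun P 1.
  by apply/Lfun1_integrable; exact: integrable_indic.
have <- : 'E_P[s]%E = (p * g x + q * g y)%:E.
  rewrite expectationD ?Lfun_scale// !expectationZl// !expectation_indic//.
  by rewrite Px Py -!EFinM -EFinD ![g _ * _]mulrC.
rewrite unlock; apply: ae_eq_integral => //.
- by apply/measurable_EFinP; exact: measurableT_comp.
- apply/measurable_EFinP; apply: measurable_funD;
    by apply: measurable_funM.
(* The two functions differ at most outside both fibres. *)
exists (~` (A `|` B)); split; first by apply: measurableC; exact: measurableU.
- have PAB : P (A `|` B) = 1%E.
    apply: etrans (measureU P mA mB AB0) _.
    by apply: etrans (congr2 (fun a b => a + b)%E Px Py) _; rewrite -EFinD pq.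
  apply: etrans (probability_setC P (measurableU _ _ mA mB)) _.
  by rewrite PAB -EFinB subrr.
- apply: subsetC => w ABw _ /=; congr EFin; rewrite /s /= !indicE.
  case: ABw => Yw; rewrite (mem_set Yw).
    rewrite memNset; last by move=> Bw; have : (A `&` B) w by []; rewrite AB0.
    by rewrite Yw mul0r mul1r addr0.
  rewrite memNset; last by move=> Aw; have : (A `&` B) w by []; rewrite AB0.
  by rewrite Yw mul0r mul1r add0r.
Qed.

Lemma two_point_mean_variance (x p y q m v : R) :
  x != y -> p + q = 1 -> two_point_law Y x p y q ->
  p * x + q * y = m -> p * (x - m) ^+ 2 + q * (y - m) ^+ 2 = v ->
  has_mean_variance Y m v.
Proof.
move=> xy pq law meanE varE; apply/has_mean_varianceE; split.
  rewrite -meanE -(expectation_two_point xy pq law (g := id))//.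
rewrite -varE.
rewrite -(expectation_two_point xy pq law (g := fun u => (u - m) ^+ 2))//.
by apply: measurable_funX; apply: measurable_funB.
Qed.

End moments.

Lemma two_point_law_exists (R : realType) (x p y q : R) :
  x != y -> 0 <= p -> 0 <= q -> p + q = 1 ->
  exists (d : measure_display) (T : measurableType d) (P : probability T R)
    (Y : {RV P >-> R}), two_point_law Y x p y q.
Proof.
move=> xy p0 q0 pq; pose f (b : bool) := if b then x else y.
have mf : measurable_fun setT f by [].
pose F : {mfun bool >-> R} := mfun_Sub (mem_set mf).
exists _, bool, (bernoulli_prob p), F.
have p01 : 0 <= p <= 1 by apply/andP; split; lra.
have fx : F @^-1` [set x] = [set true].
  apply/seteqP; split => -[] //=.
  by move/eqP; rewrite eq_sym (negbTE xy).
have fy : F @^-1` [set y] = [set false].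
  apply/seteqP; split => -[] //=.
  by move/eqP; rewrite (negbTE xy).
rewrite /two_point_law fx fy; split; rewrite /= bernoulli_probE//.
  rewrite !diracE mem_set// memNset//= mule1 mule0 adde0//.
rewrite !diracE memNset// mem_set//= mule1 mule0 add0e.
by have -> : q = 1 - p by rewrite -pq addrC addKr.
Qed.

(** * The function 1 / max(y, 1) and its expectation *)

Section inv_max1.
Context (R : realType).

Definition inv_max1 (y : R) : R := 1 / Num.max y 1.

Lemma inv_max1_ge0 y : 0 <= inv_max1 y.
Proof. by rewrite divr_ge0// le_max ler01 orbT. Qed.

Lemma inv_max1_le1 y : inv_max1 y <= 1.
Proof.
rewrite /inv_max1 div1r invf_le1 ?lt_max ?ltr01 ?orbT//.
by rewrite le_max lexx orbT.
Qed.

Lemma inv_max1_le z : z <= 1 -> inv_max1 z = 1.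
Proof. by move=> z1; rewrite /inv_max1 max_r// divr1. Qed.

Lemma inv_max1_ge z : 1 <= z -> inv_max1 z = z^-1.
Proof. by move=> z1; rewrite /inv_max1 max_l// div1r. Qed.

Lemma inv_max1_eq1 y : inv_max1 y = 1 -> y <= 1.
Proof.
case: (leP y 1) => // y1; rewrite inv_max1_ge ?ltW// => /eqP.
by rewrite invr_eq1 => /eqP y_eq1; rewrite y_eq1 ltxx in y1.
Qed.

(** The right-hand side is [1 / a - (y - a) / a ^+ 2 + (y - a) ^+ 2 / a ^+ 2],
    the parabola tangent to [1 / y] at [a] with value 1 at 1.  After
    multiplication by [a ^+ 2], its excess over the left-hand side is
    [(y - 1) * (y - a) ^+ 2 / y] for [1 <= y] and [(y - 1) * (y - 2 * a)] for
    [y <= 1]. *)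
Lemma inv_max1_le_tangent_parabola (a y : R) : 1 <= a ->
  inv_max1 y <= (y ^+ 2 - (2 * a + 1) * y + a ^+ 2 + 2 * a) / a ^+ 2.
Proof.
move=> a1; have a0 : 0 < a by lra.
have a20 : 0 < a ^+ 2 by rewrite exprn_gt0.
rewrite ler_pdivlMr//; case: (lerP y 1) => y1.
  by rewrite inv_max1_le// mul1r; nra.
have y0 : 0 < y by lra.
rewrite (inv_max1_ge (ltW y1)) ler_pdivrMl// -subr_ge0.
rewrite (_ : _ - _ = (y - 1) * (y - a) ^+ 2); last by ring.
by rewrite mulr_ge0 ?sqr_ge0// subr_ge0 ltW.
Qed.

Lemma measurable_inv_max1 : measurable_fun setT inv_max1.
Proof.
apply: continuous_measurable_fun => y.
apply: cvgM; first exact: cvg_cst.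
apply: cvgV; first by rewrite gt_eqF// lt_max ltr01 orbT.
by apply: continuous_max; [exact: cvg_id|exact: cvg_cst].
Qed.

Section rv.
Context (d : measure_display) (T : measurableType d) (P : probability T R)
  (Y : {RV P >-> R}).

Let mInv : measurable_fun setT (inv_max1 \o Y).
Proof. exact: measurableT_comp measurable_inv_max1 _. Qed.

Lemma expectation_inv_max1E :
  expectation_inv_max1 Y = 'E_P[inv_max1 \o Y]%E.
Proof. by []. Qed.

Lemma expectation_inv_max1_le1 : (expectation_inv_max1 Y <= 1)%E.
Proof.
rewrite expectation_inv_max1E -(expectation_cst P 1).
apply: expectation_le => //.
- by move=> w; exact: inv_max1_ge0.
- by apply: aeW => w; exact: inv_max1_le1.
Qed.

(** The tangency point is the atom other than 1 of the two-point law with mean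
    [mu] and variance [v], so nothing is lost for that law. *)
Lemma expectation_inv_max1_le_bound (mu v : R) : 1 < mu ->
  has_mean_variance Y mu v ->
  (expectation_inv_max1 Y <=
   (1 - (mu - 1) ^+ 2 / (v + mu ^+ 2 - mu))%:E)%E.
Proof.
move=> mu1 mvY.
have v0 : 0 <= v by case: mvY => _ VY; rewrite -lee_fin -VY variance_ge0.
pose a := mu + v / (mu - 1).
have m10 : 0 < mu - 1 by rewrite subr_gt0.
have a1 : 1 <= a by rewrite /a; have := divr_ge0 v0 (ltW m10); lra.
have a0 : a != 0 by rewrite gt_eqF//; lra.
have aE : a * (mu - 1) = v + mu ^+ 2 - mu.
  by rewrite /a mulrDl divfK ?gt_eqF//; ring.
rewrite expectation_inv_max1E.
(* Coefficients of the tangent parabola expanded around mu. *)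
apply: le_trans (expectation_le_quadratic
  (c0 := (mu ^+ 2 - (2 * a + 1) * mu + a ^+ 2 + 2 * a) / a ^+ 2)
  (c1 := (2 * mu - (2 * a + 1)) / a ^+ 2) (c2 := 1 / a ^+ 2)
  mvY measurable_inv_max1 _) _.
  move=> y; rewrite inv_max1_ge0/=.
  apply: le_trans (inv_max1_le_tangent_parabola y a1) _.
  by rewrite le_eqVlt; apply/orP; left; apply/eqP; field.
rewrite lee_fin -aE le_eqVlt; apply/orP; left; apply/eqP.
have -> : v = a * (mu - 1) - mu ^+ 2 + mu by rewrite aE; ring.
by field; rewrite a0 gt_eqF.
Qed.

(** Expectation 1 forces [inv_max1 \o Y = 1], hence [Y <= 1], almost surely; then
    [1 - Y] is nonnegative with expectation 0, so [Y = 1] almost surely and the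
    variance is 0. *)
Lemma expectation_inv_max1_neq1 (v : R) : 0 < v ->
  has_mean_variance Y 1 v -> expectation_inv_max1 Y <> 1%E.
Proof.
move=> v0 mvY; rewrite expectation_inv_max1E => Einv.
have [EY VY] := (has_mean_varianceE Y 1 v).1 mvY.
have inv1 : inv_max1 \o Y \in Lfun P 1.
  apply/Lfun1_integrable.
  apply: (@le_integrable _ _ _ _ _ _ _ (EFin \o cst 1)) => //.
  - exact/measurable_EFinP.
  - move=> w _ /=; rewrite lee_fin normr1 ger0_norm ?inv_max1_ge0//.
    exact: inv_max1_le1.
  - by apply/Lfun1_integrable; exact: Lfun_cst.
have Y_le1 : {ae P, forall w, Y w <= 1}.
  have : {ae P, forall w, (cst 1 \- (inv_max1 \o Y)) w = 0}.
    apply: expectation_eq0_ae.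
    - by apply: measurable_funB.
    - by apply: aeW => w /=; rewrite subr_ge0 inv_max1_le1.
    - by rewrite expectationB ?Lfun_cst// expectation_cst Einv -EFinB subrr.
  by apply: filterS => w /= /subr0_eq /esym /inv_max1_eq1.
have Y_eq1 : {ae P, forall w, 1 - Y w = 0}.
  apply: expectation_eq0_ae.
  - by apply: measurable_funB.
  - by apply: filterS Y_le1 => w; rewrite subr_ge0.
  - have := expectation_quadratic 0 (- 1) 0 mvY.
    rewrite mul0r addr0 => E; apply: etrans E.
    by congr expectation; apply/funext => w; ring.
have : 'E_P[fun w => ((Y w - 1) ^+ 2)%R]%E = 0%E.
  apply: etrans (expectation_cst P 0).
  rewrite unlock; apply: ae_eq_integral => //.
  - by apply/measurable_EFinP; apply: measurable_funX; apply: measurable_funB.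
  - exact/measurable_EFinP.
  - by apply: filterS Y_eq1 => w /= /subr0_eq Yw _; rewrite -Yw subrr expr0n.
by rewrite VY => -[] v_eq0; rewrite v_eq0 ltxx in v0.
Qed.

End rv.
End inv_max1.

Lemma expectation_inv_max1_two_point (R : realType) (d : measure_display)
    (T : measurableType d) (P : probability T R) (Y : {RV P >-> R})
    (x p y q : R) :
  x != y -> p + q = 1 -> two_point_law Y x p y q ->
  expectation_inv_max1 Y = (p * inv_max1 x + q * inv_max1 y)%:E.
Proof.
move=> xy pq law.
by apply: (expectation_two_point xy pq law); exact: measurable_inv_max1.
Qed.

(** * The two-point law with an atom at 1 *)

Section law_at_1.
Context (R : realType) (mu v : R).
Hypotheses (mu1 : mu != 1) (v0 : 0 <= v).

Let x2 : R := mu + v / (mu - 1).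
Let p1 : R := v / (v + (mu - 1) ^+ 2).
Let p2 : R := (mu - 1) ^+ 2 / (v + (mu - 1) ^+ 2).

Let mu10 : mu - 1 != 0. Proof. by rewrite subr_eq0. Qed.

Let D0 : 0 < v + (mu - 1) ^+ 2.
Proof. by rewrite ltr_wpDl// exprn_even_gt0. Qed.

Let x2E : x2 - 1 = (v + (mu - 1) ^+ 2) / (mu - 1).
Proof. by rewrite /x2; field. Qed.

Let x21 : 1 != x2.
Proof.
by rewrite -subr_eq0 -oppr_eq0 opprB x2E mulf_neq0 ?invr_eq0// gt_eqF.
Qed.

Let p12 : p1 + p2 = 1.
Proof. by rewrite /p1 /p2 -mulrDl divff// gt_eqF. Qed.

Lemma law_at_1_exists :
  exists (d : measure_display) (T : measurableType d) (P : probability T R)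
    (Y : {RV P >-> R}), two_point_law Y 1 p1 x2 p2.
Proof.
apply: two_point_law_exists => //; first exact: divr_ge0 (ltW D0).
by apply: divr_ge0 (ltW D0); exact: sqr_ge0.
Qed.

Context (d : measure_display) (T : measurableType d) (P : probability T R)
  (Y : {RV P >-> R}).
Hypothesis law : two_point_law Y 1 p1 x2 p2.

Lemma law_at_1_mean_variance : has_mean_variance Y mu v.
Proof.
have D00 := lt0r_neq0 D0.
apply: (two_point_mean_variance x21 p12 law); rewrite /p1 /p2 /x2;
  by field; rewrite D00 mu10.
Qed.

Lemma law_at_1_expectation_gt1 : 1 < mu ->
  expectation_inv_max1 Y = (1 - (mu - 1) ^+ 2 / (v + mu ^+ 2 - mu))%:E.
Proof.
move=> mu_gt1; rewrite (expectation_inv_max1_two_point x21 p12 law).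
have m10 : 0 < mu - 1 by rewrite subr_gt0.
have x2_ge1 : 1 <= x2 by rewrite -subr_ge0 x2E divr_ge0// ltW.
rewrite inv_max1_le// inv_max1_ge// /p1 /p2 /x2; congr EFin.
have D00 := lt0r_neq0 D0.
have mm0 : 0 < mu * (mu - 1) by rewrite mulr_gt0// (lt_trans ltr01).
have E0 : v + mu ^+ 2 - mu != 0.
  by rewrite (_ : _ - _ = mu * (mu - 1) + v) ?gt_eqF ?ltr_wpDr//; ring.
by field; rewrite E0 mu10 D00.
Qed.

Lemma law_at_1_expectation_lt1 : mu < 1 -> expectation_inv_max1 Y = 1%E.
Proof.
move=> mu_lt1; rewrite (expectation_inv_max1_two_point x21 p12 law).
have x2_le1 : x2 <= 1.
  rewrite -subr_le0 x2E; apply: mulr_ge0_le0; first exact: ltW.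
  by rewrite invr_le0 subr_le0 ltW.
by rewrite !inv_max1_le// !mulr1 p12.
Qed.

End law_at_1.

(** * Mean 1 *)

Section critical_mean.
Context (R : realType) (v : R).
Hypothesis v0 : 0 <= v.

Let value (eps : R) : R := 1 - (v * eps) / ((v + eps ^+ 2) * (1 + eps)).

Lemma critical_value_bounds (eps : R) : 0 < eps -> 1 - eps <= value eps <= 1.
Proof.
move=> e0.
have e20 : 0 < eps ^+ 2 by rewrite exprn_gt0.
have D0 : 0 < v + eps ^+ 2 by rewrite ltr_wpDl.
have DD0 : 0 < (v + eps ^+ 2) * (1 + eps) by rewrite mulr_gt0//; lra.
rewrite /value lerD2l lerN2 ler_pdivrMr// gerBl.
rewrite divr_ge0 ?(ltW DD0) ?mulr_ge0 ?(ltW e0)// andbT.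
rewrite mulrC ler_pM2l//; nra.
Qed.

Lemma critical_value_cvg : value eps @[eps --> 0^'+] --> (1 : R).
Proof.
apply: (@squeeze_cvgr _ _ _ _ (fun eps => 1 - eps) (cst 1)).
- near=> eps; apply: critical_value_bounds.
  by near: eps; exact: nbhs_right_gt.
- rewrite -[X in _ --> X]subr0; apply: cvgB; first exact: cvg_cst.
  by apply: cvg_at_right_filter; exact: cvg_id.
- exact: cvg_cst.
Unshelve. all: by end_near.
Qed.

(** Clearing denominators, the comparison of the values at [e1 < e2] has the sign
    of [v - e1 * e2 * (1 + e1 + e2)]; below 1 the last factor is less than 3,
    whence the threshold [v / 3]. *)
Lemma critical_value_decreasing : 0 < v ->
  exists2 delta : R, 0 < delta &
    forall e1 e2 : R, 0 < e1 -> e1 < e2 -> e2 < delta -> value e2 < value e1.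
Proof.
move=> vp; exists (Num.min 1 (v / 3)); first by rewrite lt_min ltr01 divr_gt0.
move=> e1 e2 e10 e12; rewrite lt_min => /andP[e21 e2v].
have e20 : 0 < e2 by lra.
have D0 e : 0 < e -> 0 < (v + e ^+ 2) * (1 + e).
  by move=> e0; rewrite mulr_gt0 ?addr_gt0 ?exprn_gt0.
have e12_gt0 : 0 < e1 * e2 by rewrite mulr_gt0.
have key : e1 * e2 * (1 + e1 + e2) < v.
  have h1 : e1 * e2 < v / 3 by nra.
  by nra.
rewrite /value ltrD2l ltrN2 ltr_pdivrMr ?D0// mulrAC ltr_pdivlMr ?D0//.
rewrite -subr_gt0.
rewrite (_ : _ - _ = v * (e2 - e1) * (v - e1 * e2 * (1 + e1 + e2))).
  2: by ring.
by rewrite !mulr_gt0 ?subr_gt0.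
Qed.

Section law.
Variable eps : R.
Hypothesis eps0 : 0 < eps.

Let p : R := v / (v + eps ^+ 2).
Let q : R := eps ^+ 2 / (v + eps ^+ 2).

Let D0 : 0 < v + eps ^+ 2.
Proof. by rewrite ltr_wpDl// exprn_gt0. Qed.

Let pq : p + q = 1.
Proof. by rewrite /p /q -mulrDl divff// gt_eqF. Qed.

Let xy : 1 + eps != 1 - v / eps.
Proof.
rewrite gt_eqF// ltrD2l (le_lt_trans _ eps0)//.
by rewrite oppr_le0 divr_ge0// ltW.
Qed.

Lemma critical_law_exists :
  exists (d : measure_display) (T : measurableType d) (P : probability T R)
    (Y : {RV P >-> R}), two_point_law Y (1 + eps) p (1 - v / eps) q.
Proof.
apply: two_point_law_exists => //; first exact: divr_ge0 (ltW D0).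
by apply: divr_ge0 (ltW D0); exact: sqr_ge0.
Qed.

Lemma critical_law_moments (d : measure_display) (T : measurableType d)
    (P : probability T R) (Y : {RV P >-> R}) :
  two_point_law Y (1 + eps) p (1 - v / eps) q ->
  has_mean_variance Y 1 v /\ expectation_inv_max1 Y = (value eps)%:E.
Proof.
move=> law; have D00 := lt0r_neq0 D0; have e00 := lt0r_neq0 eps0.
split.
  by apply: (two_point_mean_variance xy pq law); rewrite /p /q;
    field; rewrite D00 e00.
rewrite (expectation_inv_max1_two_point xy pq law).
rewrite inv_max1_ge; last by rewrite lerDl ltW.
rewrite inv_max1_le; last by rewrite gerBl divr_ge0// ltW.
have e10 : 1 + eps != 0 by rewrite gt_eqF// addr_gt0.
by rewrite /value /p /q; congr EFin; field; rewrite D00 e10.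
Qed.

End law.

(** An upper bound dominates the values of the two-point laws, which are at least
    [1 - eps]; for [v = 0] these laws degenerate to the point mass at 1. *)
Lemma supremums_critical_values : supremums (inv_max1_values (1 : R) v) 1%E.
Proof.
split=> [_ [d [T [P [Y [_ ->]]]]]|u ub_u].
  exact: expectation_inv_max1_le1.
apply/lee_subgt0Pr => eps eps0.
have [d [T [P [Y /(critical_law_moments eps0)[mvY EY]]]]] :=
  critical_law_exists eps0.
apply: (@le_trans _ _ (value eps)%:E).
  by rewrite -EFinB lee_fin; have /andP[] := critical_value_bounds eps0.
by apply: ub_u; exists d, T, P, Y.
Qed.

End critical_mean.

Theorem lemmaA3 (R : realType) (mu sigma : R) :
  let x2 : R := mu + sigma ^+ 2 / (mu - 1) in
  let p1 : R := sigma ^+ 2 / (sigma ^+ 2 + (mu - 1) ^+ 2) in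
  let p2 : R := (mu - 1) ^+ 2 / (sigma ^+ 2 + (mu - 1) ^+ 2) in
  let bound : R := 1 - (mu - 1) ^+ 2 / (sigma ^+ 2 + mu ^+ 2 - mu) in
  let value : R -> R := fun eps : R =>
    1 - (sigma ^+ 2 * eps) / ((sigma ^+ 2 + eps ^+ 2) * (1 + eps)) in
  (* (i) *)
  (1 < mu ->
    [/\ forall (d : measure_display) (T : measurableType d)
          (P : probability T R) (Y : {RV P >-> R}),
          has_mean_variance Y mu (sigma ^+ 2) ->
          (expectation_inv_max1 Y <= bound%:E)%E,
        forall (d : measure_display) (T : measurableType d)
          (P : probability T R) (Y : {RV P >-> R}),
          two_point_law Y 1 p1 x2 p2 ->
          has_mean_variance Y mu (sigma ^+ 2) /\
          expectation_inv_max1 Y = bound%:E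
      & exists (d : measure_display) (T : measurableType d)
          (P : probability T R) (Y : {RV P >-> R}),
          two_point_law Y 1 p1 x2 p2]) /\
  (* (ii) *)
  (mu < 1 ->
    [/\ forall (d : measure_display) (T : measurableType d)
          (P : probability T R) (Y : {RV P >-> R}),
          has_mean_variance Y mu (sigma ^+ 2) ->
          (expectation_inv_max1 Y <= 1)%E,
        forall (d : measure_display) (T : measurableType d)
          (P : probability T R) (Y : {RV P >-> R}),
          two_point_law Y 1 p1 x2 p2 ->
          has_mean_variance Y mu (sigma ^+ 2) /\
          expectation_inv_max1 Y = 1%E
      & exists (d : measure_display) (T : measurableType d)
          (P : probability T R) (Y : {RV P >-> R}),
          two_point_law Y 1 p1 x2 p2]) /\
  (* (iii) *)
  (mu = 1 ->
    supremums (inv_max1_values mu (sigma ^+ 2)) 1%E /\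
    (0 < sigma ^+ 2 ->
      [/\ ~ inv_max1_values mu (sigma ^+ 2) 1%E,
          forall eps : R, 0 < eps ->
            forall (d : measure_display) (T : measurableType d)
              (P : probability T R) (Y : {RV P >-> R}),
              two_point_law Y
                (1 + eps) (sigma ^+ 2 / (sigma ^+ 2 + eps ^+ 2))
                (1 - sigma ^+ 2 / eps) (eps ^+ 2 / (sigma ^+ 2 + eps ^+ 2)) ->
              has_mean_variance Y mu (sigma ^+ 2) /\
              expectation_inv_max1 Y = (value eps)%:E,
          forall eps : R, 0 < eps ->
            exists (d : measure_display) (T : measurableType d)
              (P : probability T R) (Y : {RV P >-> R}),
              two_point_law Y
                (1 + eps) (sigma ^+ 2 / (sigma ^+ 2 + eps ^+ 2))
                (1 - sigma ^+ 2 / eps) (eps ^+ 2 / (sigma ^+ 2 + eps ^+ 2)),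
          value eps @[eps --> 0^'+] --> (1 : R)
        & exists2 delta : R, 0 < delta &
            forall e1 e2 : R, 0 < e1 -> e1 < e2 -> e2 < delta ->
              value e2 < value e1])).
Proof.
move=> x2 p1 p2 bound value; have v0 : 0 <= sigma ^+ 2 := sqr_ge0 _.
split; [|split].
- move=> mu1; have mu_neq1 : mu != 1 by rewrite gt_eqF.
  split=> [d T P Y mvY|d T P Y law|].
  + exact: expectation_inv_max1_le_bound.
  + split; first exact: law_at_1_mean_variance law.
    exact: law_at_1_expectation_gt1 law mu1.
  + exact: law_at_1_exists.
- move=> mu1; have mu_neq1 : mu != 1 by rewrite lt_eqF.
  split=> [d T P Y _|d T P Y law|].
  + exact: expectation_inv_max1_le1.
  + split; first exact: law_at_1_mean_variance law.
    exact: law_at_1_expectation_lt1 law mu1.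
  + exact: law_at_1_exists.
- move=> ->; split=> [|vp]; first exact: supremums_critical_values.
  split.
  + move=> [d [T [P [Y [mvY /esym]]]]].
    exact: expectation_inv_max1_neq1 mvY.
  + by move=> eps eps0 d T P Y; exact: critical_law_moments.
  + by move=> eps eps0; exact: critical_law_exists.
  + exact: critical_value_cvg.
  + exact: critical_value_decreasing.
Qed.
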